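(* The high-SNR slopes of the sensing rates $\mathcal{R}_{\mathrm{i}}^{\mathrm{s}}$ of NOMA-ISAC and $\mathcal{R}_{\mathrm{f}}^{\mathrm{s}}$ of NOMA-FDSAC are $\frac{\mathsf{r}}{L}$ and $\frac{(1-\kappa)\mathsf{r}}{L}$, respectively, where $\mathsf{r}=\mathrm{rank}(\mathbf{R})$ is the rank of the correlation matrix $\mathbf{R}=\mathbb{E}\{\mathbf{g}\mathbf{g}^{\mathsf{H}}\}$ of the target response vector $\mathbf{g}$.
   Context: A base station with one transmit antenna and $M$ receive antennas senses radar targets by transmitting a waveform $\mathbf{x}\in\mathbb{C}^{L\times1}$ of length $L$ and observing the echo $\mathbf{Y}_{\mathrm{s}}=\mathbf{g}\mathbf{x}^{\mathsf{T}}+\mathbf{N}_{\mathrm{s}}\in\mathbb{C}^{M\times L}$, where $\mathbf{N}_{\mathrm{s}}$ is additive white Gaussian noise. The target response vector is $\mathbf{g}=\sum_k\beta_k\mathbf{a}(\theta_k)\in\mathbb{C}^{M\times1}$, where $\beta_k\sim\mathcal{CN}(0,\sigma_k^2)$ is the complex amplitude of the $k$th target, $\theta_k$ its angle of arrival, and $\mathbf{a}(\theta_k)\in\mathbb{C}^{M\times1}$ the associated receive array steering vector. The sensing rate is the sensing mutual information per unit time, where the sensing mutual information is the mutual information $I(\mathbf{Y}_{\mathrm{s}};\mathbf{g}\,|\,\mathbf{x})$ (in bits) between $\mathbf{Y}_{\mathrm{s}}$ and $\mathbf{g}$ conditioned on $\mathbf{x}$. Let $p$ be the power budget per time slot and $\sigma_{\mathrm{s}}^2$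 the sensing noise variance of each entry of $\mathbf{N}_{\mathrm{s}}$ when the whole bandwidth is used. Integrated sensing and communications (ISAC) with nonorthogonal multiple access (NOMA): $\mathbf{x}^{\mathsf{T}}=\sqrt{p}\,[\sqrt{\alpha_{\mathrm{N}}},\sqrt{\alpha_{\mathrm{F}}}]\,\mathbf{S}$, with power allocation factors satisfying $\alpha_{\mathrm{N}}+\alpha_{\mathrm{F}}=1$, $\alpha_{\mathrm{N}}<\alpha_{\mathrm{F}}$, and $\mathbf{S}\in\mathbb{C}^{2\times L}$ containing two independent unit-power data streams, so that $\mathbf{S}\mathbf{S}^{\mathsf{H}}\approx L\mathbf{I}_2$. Each waveform symbol lasts one unit time, so $\mathcal{R}_{\mathrm{i}}^{\mathrm{s}}=L^{-1}I(\mathbf{Y}_{\mathrm{s}};\mathbf{g}\,|\,\mathbf{x})$, which is given by $\mathcal{R}_{\mathrm{i}}^{\mathrm{s}}=L^{-1}\log_2\det(\mathbf{I}_M+pL\sigma_{\mathrm{s}}^{-2}\mathbf{R})$. Frequency-division sensing and communications (FDSAC) with NOMA: with $\kappa\in[0,1]$ and $\mu\in[0,1]$, a fraction $\kappa$ of the total bandwidth and power $\mu p$ are used for communications, and the remaining fraction $1-\kappa$ of the bandwidth and power $(1-\mu)p$ are used for sensing only. Its sensing rate is given by $\mathcal{R}_{\mathrm{f}}^{\mathrm{s}}=\frac{1-\kappa}{L}\log_2\det\left(\mathbf{I}_M+\frac{(1-\mu)pL}{(1-\kappa)\sigma_{\mathrm{s}}^2}\mathbf{R}\right)$. The high-SNR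 slope of a rate $\mathcal{R}$ is $\lim_{p\to\infty}\frac{\mathcal{R}}{\log_2p}$, with all other parameters fixed.
   Formalization: For NOMA-FDSAC it is assumed that μ < 1 whenever κ < 1: with μ = 1 and κ < 1 no power is left for sensing, the rate is identically 0, and the claimed slope fails for r > 0. At κ = 1, where the rate formula divides by zero, the rate is read as 0. *)

(* Defs.v *)
From HB Require Import structures.
From mathcomp Require Import all_boot all_order all_algebra.
From mathcomp Require Import all_classical all_reals all_analysis.
From mathcomp Require Import complex.
Import Order.TTheory GRing.Theory Num.Theory.
Import numFieldNormedType.Exports.

Set Implicit Arguments.
Unset Strict Implicit.
Unset Printing Implicit Defensive.

Local Open Scope classical_set_scope.
Local Open Scope ring_scope.
Local Open Scope complex_scope.

Definition log2 {R : realType} (x : R) : R := ln x / ln 2.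

(* N(0, s^2).  The case s = 0 is the point mass at 0; it is treated apart
   because [normal_prob m 0] is by convention the uniform law on [0, 1]. *)
Definition centered_normal {R : realType} (s : R) (A : set R) : \bar R :=
  if s == 0 then \d_(0 : R) A else normal_prob 0 s A.

(* Z ~ CN(0, v): the real and imaginary parts of Z are independent, each with
   law N(0, v / 2). *)
Definition circular_normal {R : realType} {d : measure_display}
    {T : measurableType d} (P : probability T R) (Z : T -> R[i]) (v : R) : Prop :=
  [/\ measurable_fun setT (fun w => complex.Re (Z w)),
      measurable_fun setT (fun w => complex.Im (Z w)) &
      forall A B : set R, measurable A -> measurable B ->
        P [set w | A (complex.Re (Z w)) /\ B (complex.Im (Z w))]
        = (centered_normal (Num.sqrt (v / 2)) A
           * centered_normal (Num.sqrt (v / 2)) B)%E].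

Definition cexpectation {R : realType} {d : measure_display}
    {T : measurableType d} (P : probability T R) (Z : T -> R[i]) : R[i] :=
  fine 'E_P[fun w => complex.Re (Z w)] +i* fine 'E_P[fun w => complex.Im (Z w)].

Definition target_response {R : realType} {T : Type} {K M : nat}
    (a : R -> 'cV[R[i]]_M) (theta : 'I_K -> R) (beta : 'I_K -> T -> R[i])
    (w : T) : 'cV[R[i]]_M :=
  \sum_(k < K) beta k w *: a (theta k).

(* E{g g^H}, the expectation being taken entrywise. *)
Definition correlation_mx {R : realType} {d : measure_display}
    {T : measurableType d} (P : probability T R) {M : nat}
    (g : T -> 'cV[R[i]]_M) : 'M[R[i]]_M :=
  \matrix_(i, j) cexpectation P (fun w => (g w *m map_mx Num.conj (g w)^T) i j).

(* log_2 det(I_M + c C).  For real c >= 0 and C a correlation matrix the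
   determinant is a positive real number, so that taking its real part only
   changes its type. *)
Definition log2det {R : realType} {M : nat} (c : R) (C : 'M[R[i]]_M) : R :=
  log2 (complex.Re (\det (1%:M + c%:C *: C))).

(* L^-1 log_2 det(I_M + p L sigma_s^-2 C), the value of the normalised mutual
   information L^-1 I(Y_s; g | x) when ||x||^2 = p L. *)
Definition sensing_rate_isac {R : realType} {M : nat} (L : nat) (sigmas : R)
    (C : 'M[R[i]]_M) (p : R) : R :=
  L%:R^-1 * log2det (p * L%:R / sigmas ^+ 2) C.

(* At kappa = 1 (no sensing bandwidth) the convention x / 0 = 0 makes this
   rate 0, which is also its limit as kappa tends to 1. *)
Definition sensing_rate_fdsac {R : realType} {M : nat} (L : nat) (sigmas : R)
    (kappa mu : R) (C : 'M[R[i]]_M) (p : R) : R :=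
  (1 - kappa) / L%:R
  * log2det ((1 - mu) * p * L%:R / ((1 - kappa) * sigmas ^+ 2)) C.

Definition high_snr_slope {R : realType} (rate : R -> R) (l : R) : Prop :=
  (fun p : R => rate p / log2 p) @ +oo --> l.

(* Main.v *)
Require Import Defs.
From HB Require Import structures.
From mathcomp Require Import all_boot all_order all_algebra.
From mathcomp Require Import all_classical all_reals all_analysis.
From mathcomp Require Import measurable_realfun complex.
From mathcomp Require Import ring lra.
Import Order.TTheory GRing.Theory Num.Theory.
Import numFieldNormedType.Exports.

(** The correlation matrix is Hermitian and positive semidefinite: the Gaussian
    amplitudes have finite second moments, so that u R u^H = E|u g|^2.  By the
    spectral theorem det(I + c R) is the product of the 1 + c r_i over the
    eigenvalues r_i >= 0, and rank(R) of them are nonzero.  As p tends to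
    infinity, ln(1 + k r_i p) / ln p tends to 1 if r_i > 0 and vanishes if
    r_i = 0; summing over i gives the rank. *)

Local Open Scope ring_scope.

(** * Ranks and determinants through eigenvalues *)

Lemma mxrank_diag (F : fieldType) (n : nat) (v : 'rV[F]_n) :
  \rank (diag_mx v) = #|[pred i | v 0 i != 0]|.
Proof.
rewrite -sum1_card big_mkcond/=; elim: n v => [|n IHn] v.
  by rewrite big_ord0; apply/eqP; rewrite -leqn0 rank_leq_row.
(* Reading [n.+1] as [1 + n] splits off the first entry, which turns the diagonal matrix into a
   block diagonal one whose rank is the sum of the ranks of the blocks. *)
rewrite -[n.+1]/(1 + n)%N in v *.
have {1}-> : v = row_mx (lsubmx v) (rsubmx v) by rewrite hsubmxK.
rewrite diag_mx_row rank_diag_block_mx IHn big_split_ord/= big_ord1.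
have lE : lsubmx v 0 0 = v 0 (lshift n 0) by rewrite mxE.
congr (_ + _)%N.
  rewrite rank_rV inE -lE.
  have -> : (diag_mx (lsubmx v) != 0) = (lsubmx v 0 0 != 0).
    congr negb; apply/eqP/eqP => [/matrixP/(_ 0 0)|v0]; first by rewrite !mxE.
    by apply/matrixP => i j; rewrite !ord1 [LHS]mxE v0 mul0rn mxE.
  by case: ifP.
by apply: eq_bigr => i _; rewrite !inE mxE.
Qed.

(** With [C = invmx U *m diag_mx v *m U] and [U] unitary, [v 0 i] is the value of the quadratic form
    at the i-th row of [U]. It is therefore real and nonnegative, and its real part serves as the
    witness [r i]. *)
Lemma psd_spectral (R : realType) (n : nat) (C : 'M[R[i]]_n) :
  C = map_mx Num.conj C^T ->
  (forall u : 'rV[R[i]]_n, 0 <= (u *m C *m map_mx Num.conj u^T) 0 0) ->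
  exists r : 'I_n -> R,
    [/\ forall i, 0 <= r i, \rank C = #|[pred i | r i != 0]| &
        forall c : R,
          complex.Re (\det (1%:M + (c%:C)%C *: C)) = \prod_i (1 + c * r i)].
Proof.
move=> Cherm Cpsd.
have /hermitian_normalmx /orthomx_spectralP : C \is hermsymmx.
  by apply/is_hermitianmxP; rewrite expr0 scale1r {1}Cherm.
set U := spectralmx C; set v := spectral_diag C => CE.
have Uu : U \in unitmx by exact: spectral_unit.
have v0 i : 0 <= v 0 i.
  have := Cpsd (row i U).
  suff -> : (row i U *m C *m map_mx Num.conj (row i U)^T) 0 0 = v 0 i by [].
  transitivity ((U *m C *m map_mx Num.conj U^T) i i).
    by rewrite -row_mul [LHS]mxE [RHS]mxE; apply: eq_bigr => k _; rewrite !mxE.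
  rewrite CE -invmx_unitary ?spectral_unitarymx// !mulmxA mulmxV//.
  rewrite mul1mx mulmxK//.
  by rewrite mxE eqxx.
exists (fun i => complex.Re (v 0 i)).
have vE i : (v 0 i) = ((complex.Re (v 0 i))%:C)%C.
  by rewrite RRe_real// ger0_real.
split.
- by move=> i; rewrite -lecR -vE.
- rewrite CE mxrankMfree ?row_free_unit//.
  rewrite eqmxMfull ?row_full_unit ?unitmx_inv// mxrank_diag.
  by apply: eq_card => i; rewrite !inE {1}vE; congr negb;
    apply/eqP/eqP => [[]|->].
- move=> c.
  (* The identity commutes with [U], so the same change of basis diagonalises [1 + c C]; the
     determinants of [U] and [invmx U] then cancel. *)
  pose x := \row_i (1 + (c%:C)%C * v 0 i).
  have -> : 1%:M + (c%:C)%C *: C = invmx U *m diag_mx x *m U.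
    have -> : diag_mx x = 1%:M + (c%:C)%C *: diag_mx v.
      by apply/matrixP => i j; rewrite !mxE mulrnDl mulrnAr.
    by rewrite mulmxDr mulmxDl mulmx1 mulVmx// -scalemxAr -scalemxAl -CE.
  rewrite !det_mulmx mulrC mulrA -det_mulmx mulmxV// det1 mul1r det_diag.
  have -> : \prod_i x 0 i = ((\prod_i (1 + c * complex.Re (v 0 i)))%:C)%C.
    rewrite rmorph_prod; apply: eq_bigr => i _.
    by rewrite mxE rmorphD rmorphM /= -vE.
  by [].
Qed.

(** * Logarithmic growth of the log-determinant *)

Section slopes.
Local Open Scope classical_set_scope.

Lemma cvg_ln_pinfty (R : realType) : (@ln R) @ +oo --> +oo.
Proof.
apply/cvgryPge => A; near=> x.
have x0 : 0 < x by near: x; exact: nbhs_pinfty_gt.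
rewrite -[A]expRK ler_ln ?posrE ?expR_gt0//.
Unshelve. all: by end_near. Qed.

(** For [c > 0], factoring out [p] gives [ln (1 + c * p) = ln p + ln (p^-1 + c)]; the second term
    tends to the finite value [ln c], so it disappears after division by [ln p]. For [c = 0] the
    numerator is [ln 1 = 0]. *)
Lemma ln_affine_slope (R : realType) (c : R) : 0 <= c ->
  ln (1 + c * p) / ln p @[p --> +oo] --> ((c != 0)%:R : R).
Proof.
rewrite le_eqVlt => /predU1P[<-|c0].
  rewrite eqxx; under eq_cvg do rewrite mul0r addr0 ln1 mul0r.
  exact: cvg_cst.
rewrite gt_eqF//=.
have lnV : (ln p)^-1 @[p --> +oo] --> (0 : R).
  apply/gtr0_cvgV0; last exact: cvg_ln_pinfty.
  by near=> p; rewrite ln_gt0//; near: p; exact: nbhs_pinfty_gt.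
have pV : p^-1 @[p --> +oo] --> (0 : R).
  apply/gtr0_cvgV0; last exact: cvg_id.
  by near=> p; near: p; exact: nbhs_pinfty_gt.
have lim : 1 + ln (p^-1 + c) * (ln p)^-1 @[p --> +oo] --> 1 + ln (0 + c) * 0.
  apply: cvgD; first exact: cvg_cst.
  apply: cvgM => //; apply: continuous_cvg; last exact: cvgD pV (cvg_cst c).
  by apply: continuous_ln; rewrite add0r.
rewrite mulr0 addr0 in lim.
apply: cvg_trans lim; apply: near_eq_cvg; near=> p.
have p0 : 0 < p by near: p; exact: nbhs_pinfty_gt.
have lp0 : 0 < ln p by rewrite ln_gt0//; near: p; exact: nbhs_pinfty_gt.
have -> : 1 + c * p = p * (p^-1 + c) by field; rewrite gt_eqF.
rewrite lnM ?posrE//; last by rewrite addr_gt0// invr_gt0.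
by rewrite mulrDl divff// gt_eqF.
Unshelve. all: by end_near. Qed.

Lemma ln_prod (R : realType) (I : Type) (s : seq I) (f : I -> R) :
  (forall i, 0 < f i) -> ln (\prod_(i <- s) f i) = \sum_(i <- s) ln (f i).
Proof.
move=> f0; elim: s => [|i s IHs]; first by rewrite !big_nil ln1.
by rewrite !big_cons lnM ?posrE ?IHs// prodr_gt0.
Qed.

Lemma log2det_slope (R : realType) (n : nat) (C : 'M[R[i]]_n) (k : R) :
  0 < k -> C = map_mx Num.conj C^T ->
  (forall u : 'rV[R[i]]_n, 0 <= (u *m C *m map_mx Num.conj u^T) 0 0) ->
  high_snr_slope (fun p => log2det (k * p) C) (\rank C)%:R.
Proof.
move=> k0 Ch Cp; have [r [r0 -> detE]] := psd_spectral _ _ _ Ch Cp.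
rewrite /high_snr_slope -sum1_card natr_sum.
(* Since [k > 0], replacing [r i] by [r i * k] does not change the count; each summand is now the
   limit provided by [ln_affine_slope]. *)
have -> : \sum_(i in [pred i | r i != 0]) (1%:R : R) = \sum_i (r i * k != 0)%:R.
  rewrite big_mkcond; apply: eq_bigr => i _.
  by rewrite inE mulf_eq0 (gt_eqF k0) orbF; case: eqP.
have lim : \sum_(i < n) (ln (1 + r i * k * p) / ln p) @[p --> +oo] -->
    (\sum_i (r i * k != 0)%:R : R).
  apply: (cvg_big (op := +%R)) => [|i _]; first exact: add_continuous.
  apply: ln_affine_slope; exact: mulr_ge0 (r0 i) (ltW k0).
apply: cvg_trans lim; apply: near_eq_cvg; near=> p.
have p0 : 0 < p by near: p; exact: nbhs_pinfty_gt.
rewrite /log2det /log2 detE ln_prod; last first.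
  by move=> i; rewrite ltr_pwDl// mulr_ge0// mulr_ge0// ltW.
(* Both logarithms carry the factor [(ln 2)^-1], which cancels in the quotient. *)
have ln2 : ln (2 : R) != 0 by rewrite gt_eqF// ln_gt0// ltr1n.
rewrite invfM invrK mulrACA [X in _ * X]mulVf // mulr1.
rewrite mulr_suml; apply: eq_bigr => i _.
by rewrite -mulrA (mulrC (r i)).
Unshelve. all: by end_near. Qed.

End slopes.

(** * Second moment of a centered normal law *)

Section normal_moments.
Local Open Scope classical_set_scope.
Context (R : realType).
Local Notation mu := (@lebesgue_measure R).

(** The change of variables formula produces the Radon-Nikodym derivative of the normal law, known
    only up to a null set. It agrees almost everywhere with [normal_pdf] because both have the same
    integral over every measurable set. *)
Lemma ge0_integral_normal_prob (m s : R) (f : R -> R) :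
  measurable_fun setT f -> (forall x, 0 <= f x) ->
  (\int[normal_prob m s]_x (f x)%:E =
   \int[mu]_x (f x * normal_pdf m s x)%:E)%E.
Proof.
move=> mf f0; have dom := normal_prob_dominates m s.
rewrite -(Radon_Nikodym_SigmaFinite.change_of_variables dom)//; last first.
  exact/measurable_EFinP.
under [RHS]eq_integral do rewrite EFinM.
have mEf : measurable_fun setT (EFin \o f) by exact/measurable_EFinP.
have iRN := Radon_Nikodym_SigmaFinite.f_integrable dom.
have mpdf : measurable_fun setT (fun x => (normal_pdf m s x)%:E).
  by apply/measurable_EFinP; exact: measurable_normal_pdf.
apply: ae_eq_integral => //.
- by apply: emeasurable_funM => //; exact: measurable_int iRN.
- exact: emeasurable_funM.
- apply: ae_eqe_mul2l; apply: integral_ae_eq => //.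
  by move=> E _ mE; rewrite -Radon_Nikodym_SigmaFinite.f_integral.
Qed.

(* With t = x^2 / (4 s^2) this is t exp(-2t) <= exp(-t); its right-hand side is
   proportional to the density of N(0, 2 s^2), hence integrable. *)
Lemma sqr_normal_fun_le (s x : R) : s != 0 ->
  x ^+ 2 * normal_fun 0 s x <= 4 * s ^+ 2 * normal_fun 0 (Num.sqrt 2 * s) x.
Proof.
move=> s0; have s20 : 0 < s ^+ 2 by rewrite exprn_even_gt0.
rewrite /normal_fun subr0 exprMn sqr_sqrtr//.
pose t := x ^+ 2 / (4 * s ^+ 2).
have -> : - x ^+ 2 / (s ^+ 2 *+ 2) = - t - t.
  by rewrite /t; field; rewrite s0.
have -> : - x ^+ 2 / (2 * s ^+ 2 *+ 2) = - t.
  by rewrite /t; field; rewrite s0.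
have -> : x ^+ 2 = 4 * s ^+ 2 * t.
  by rewrite /t; field; rewrite s0.
have c0 : 0 < 4 * s ^+ 2 by rewrite mulr_gt0.
rewrite -mulrA ler_pM2l// expRD mulrA ler_piMl ?expR_ge0//.
(* From [t <= 1 + t <= expR t] follows [t * expR (- t) <= 1]. *)
have := expR_ge1Dx t; have := expR_gt0 t => e0 te.
by rewrite expRN ler_pdivrMr// mul1r; lra.
Qed.

Lemma normal_prob_second_moment (s : R) : s != 0 ->
  (\int[normal_prob 0 s]_x (x ^+ 2)%:E < +oo)%E.
Proof.
move=> s0; have s20 : Num.sqrt 2 * s != 0.
  by rewrite mulf_neq0// gt_eqF// sqrtr_gt0.
rewrite ge0_integral_normal_prob//; last by move=> x; exact: sqr_ge0.
(* [K] combines the factor [4 * s ^+ 2] of [sqr_normal_fun_le] with the ratio of the two normalising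
   constants. The integrand is then at most [K] times a probability density, so its integral is at
   most [K]. *)
pose K := normal_peak s * (4 * s ^+ 2) / normal_peak (Num.sqrt 2 * s).
have K0 : 0 <= K.
  rewrite divr_ge0 ?normal_peak_ge0// mulr_ge0 ?normal_peak_ge0//.
  by rewrite mulr_ge0// sqr_ge0.
apply: (@le_lt_trans _ _
  (\int[mu]_x (K%:E * (normal_pdf 0 (Num.sqrt 2 * s) x)%:E))%E).
  apply: ge0_le_integral => //=.
  - by move=> x _; rewrite lee_fin mulr_ge0 ?sqr_ge0 ?normal_pdf_ge0.
  - apply/measurable_EFinP; apply: measurable_funM.
      exact: (@exprn_measurable R setT 2).
    exact: measurable_normal_pdf.
  - apply/measurable_EFinP; apply: measurable_funM => //.
    exact: measurable_normal_pdf.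
  - move=> x _; rewrite lee_fin /K /normal_pdf (negbTE s0) (negbTE s20).
    have -> (f : R) :
        normal_peak s * (4 * s ^+ 2) / normal_peak (Num.sqrt 2 * s) *
        (normal_peak (Num.sqrt 2 * s) * f) = normal_peak s * (4 * s ^+ 2 * f).
      by field; rewrite gt_eqF// normal_peak_gt0.
    by rewrite mulrCA ler_pM2l ?normal_peak_gt0// sqr_normal_fun_le.
rewrite ge0_integralZl//; last 2 first.
- by apply/measurable_EFinP; exact: measurable_normal_pdf.
- by move=> x _; rewrite lee_fin normal_pdf_ge0.
- by rewrite integral_normal_pdf mule1 ltry.
Qed.

End normal_moments.

(** * Square integrability read off from the law *)

Section second_moments.
Local Open Scope classical_set_scope.
Context (R : realType) (d : measure_display) (T : measurableType d).

Lemma sqr_integrable_Lfun2 (mu : {measure set T -> \bar R}) (X : T -> R) :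
  measurable_fun setT X -> (\int[mu]_w (X w ^+ 2)%:E < +oo)%E ->
  X \in Lfun mu 2%:E.
Proof.
move=> mX iX; rewrite inE; apply/andP; split; rewrite inE//=.
rewrite /finite_norm unlock poweR_lty//.
rewrite (eq_integral (fun w => (X w ^+ 2)%:E))// => w _.
(* The norm uses the power with real exponent, which coincides with the ordinary square on
   [|X w|]. *)
by rewrite -[LHS]/((`|X w| `^ 2)%:E) powR_mulrn// real_normK ?num_real.
Qed.

Lemma ge0_integral_law (d' : measure_display) (T' : measurableType d')
    (mu : {measure set T -> \bar R}) (nu : {measure set T' -> \bar R})
    (X : T -> T') (f : T' -> \bar R) :
  measurable_fun setT X -> measurable_fun setT f -> (forall x, (0 <= f x)%E) ->
  (forall A, measurable A -> mu (X @^-1` A) = nu A) ->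
  (\int[mu]_w f (X w) = \int[nu]_x f x)%E.
Proof.
move=> mX mf f0 XE.
transitivity (\int[pushforward mu X]_x f x)%E.
  by rewrite (ge0_integral_pushforward mX).
by apply: eq_measure_integral => // A mA _; exact: XE.
Qed.

(** [centered_normal] is a bare set function, so each case of its definition is first replaced by an
    actual measure, along which [ge0_integral_law] carries the second moment. That moment is 0 for
    the point mass and finite for the normal law. *)
Lemma centered_normal_Lfun2 (P : probability T R) (X : T -> R) (s : R) :
  measurable_fun setT X ->
  (forall A : set R, measurable A -> P (X @^-1` A) = centered_normal s A) ->
  X \in Lfun P 2%:E.
Proof.
move=> mX PX; apply: sqr_integrable_Lfun2 => //.
have sq_ge0 (x : R) : (0 <= (x ^+ 2)%:E)%E by rewrite lee_fin sqr_ge0.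
have msq : measurable_fun setT (fun x : R => (x ^+ 2)%:E).
  by apply/measurable_EFinP; exact: (@exprn_measurable R setT 2).
have [s0|s0] := eqVneq s 0.
  have PX0 A : measurable A -> P (X @^-1` A) = \d_(0 : R) A.
    by move=> mA; rewrite PX// /centered_normal s0 eqxx.
  rewrite (ge0_integral_law _ _ _ _ _ _ mX msq sq_ge0 PX0).
  by rewrite integral_dirac// diracT expr0n mule0.
have PXs A : measurable A -> P (X @^-1` A) = normal_prob 0 s A.
  by move=> mA; rewrite PX// /centered_normal (negbTE s0).
apply: le_lt_trans (normal_prob_second_moment _ _ s0).
by rewrite (@ge0_integral_law _ (measurableTypeR R) P (normal_prob 0 s) X _
  mX msq sq_ge0 PXs).
Qed.

End second_moments.

(** * Integrability and expectation of complex random variables *)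

Section complex_expectation.
Local Open Scope classical_set_scope.
Context (R : realType) (d : measure_display) (T : measurableType d).
Variable P : probability T R.

(** The condition is componentwise, to match [cexpectation], which integrates the two parts
    separately. *)
Definition complex_Lfun (q : \bar R) (Z : T -> R[i]) : Prop :=
  (fun w => complex.Re (Z w)) \in Lfun P q /\
  (fun w => complex.Im (Z w)) \in Lfun P q.

Lemma eq_Lfun (q : \bar R) (X Y : T -> R) :
  X =1 Y -> X \in Lfun P q -> Y \in Lfun P q.
Proof. by move=> /funext ->. Qed.

Lemma complex_LfunD (q : \bar R) (Z W : T -> R[i]) : (1 <= q)%E ->
  complex_Lfun q Z -> complex_Lfun q W -> complex_Lfun q (fun w => Z w + W w).
Proof.
move=> q1 [Zr Zi] [Wr Wi]; have [_ LD] := Lfun_addr_closed P q1.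
split; [apply: eq_Lfun (LD _ _ Zr Wr)|apply: eq_Lfun (LD _ _ Zi Wi)] => w /=.
- by rewrite ?fctE; case: (Z w) (W w) => x y [x' y'].
- by rewrite ?fctE; case: (Z w) (W w) => x y [x' y'].
Qed.

Lemma Lfun_linear (q : \bar R) (a b : R) (X Y : T -> R) : (1 <= q)%E ->
  X \in Lfun P q -> Y \in Lfun P q -> (fun w => a * X w + b * Y w) \in Lfun P q.
Proof.
move=> q1 LX LY; have [L0 LD] := Lfun_submod_closed P q1.
apply: eq_Lfun (LD b _ _ LY (LD a _ _ LX L0)) => w.
by rewrite !fctE addr0 addrC.
Qed.

Lemma complex_LfunZ (q : \bar R) (c : R[i]) (Z : T -> R[i]) : (1 <= q)%E ->
  complex_Lfun q Z -> complex_Lfun q (fun w => c * Z w).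
Proof.
move=> q1 [Zr Zi]; case: c => a b; split.
- apply: eq_Lfun (Lfun_linear q a (- b) _ _ q1 Zr Zi) => w.
  by case: (Z w) => x y /=; rewrite mulNr.
- apply: eq_Lfun (Lfun_linear q a b _ _ q1 Zi Zr) => w.
  by case: (Z w) => x y.
Qed.

Lemma complex_Lfun0 (q : \bar R) : (1 <= q)%E -> complex_Lfun q (fun=> 0).
Proof. by move=> q1; have [L0 _] := Lfun_addr_closed P q1; split. Qed.

Lemma complex_Lfun_sum (q : \bar R) (I : Type) (s : seq I)
    (Z : I -> T -> R[i]) :
  (1 <= q)%E -> (forall i, complex_Lfun q (Z i)) ->
  complex_Lfun q (fun w => \sum_(i <- s) Z i w).
Proof.
move=> q1 LZ; elim: s => [|i s IHs].
  under [X in complex_Lfun _ X]funext do rewrite big_nil.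
  exact: complex_Lfun0.
under [X in complex_Lfun _ X]funext do rewrite big_cons.
exact: complex_LfunD.
Qed.

(** Each part of [Z * conj W] is a signed sum of two products of square-integrable real functions,
    and such products are integrable by the Hölder inequality. *)
Lemma complex_Lfun2_mul_conj (Z W : T -> R[i]) :
  complex_Lfun 2%:E Z -> complex_Lfun 2%:E W ->
  complex_Lfun 1 (fun w => Z w * Num.conj (W w)).
Proof.
move=> [Zr Zi] [Wr Wi].
have rr := Lfun2_mul_Lfun1 Zr Wr; have ii := Lfun2_mul_Lfun1 Zi Wi.
have ri := Lfun2_mul_Lfun1 Zr Wi; have ir := Lfun2_mul_Lfun1 Zi Wr.
split.
- apply: eq_Lfun (Lfun_linear 1 1 1 _ _ (lexx _) rr ii) => w.
  rewrite /=; case: (Z w) (W w) => x y [x' y'].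
  by rewrite -[Num.conj _]/(conjc _) /=; ring.
- apply: eq_Lfun (Lfun_linear 1 (- 1) 1 _ _ (lexx _) ri ir) => w.
  rewrite /=; case: (Z w) (W w) => x y [x' y'].
  by rewrite -[Num.conj _]/(conjc _) /=; ring.
Qed.

(** Integrability makes both expectations finite, so that [fine] commutes with sums and products.
    The complex rules for sums, scalars and conjugates reduce to this real identity. *)
Lemma fine_expectation_linear (a b : R) (X Y : T -> R) :
  X \in Lfun P 1 -> Y \in Lfun P 1 ->
  fine 'E_P[fun w => a * X w + b * Y w] = a * fine 'E_P[X] + b * fine 'E_P[Y].
Proof.
move=> LX LY.
have L (k : R) Z : Z \in Lfun P 1 -> (k \o* Z) \in Lfun P 1.
  exact: Lfun_scale.
have -> : (fun w => a * X w + b * Y w) = (a \o* X) \+ (b \o* Y).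
  by apply/funext => w /=; rewrite (mulrC a) (mulrC b).
rewrite (expectationD (L a X LX) (L b Y LY)).
rewrite (expectationZl a LX) (expectationZl b LY).
by rewrite fineD ?fineM ?fin_numM// expectation_fin_num.
Qed.

Lemma cexpectationD (Z W : T -> R[i]) : complex_Lfun 1 Z -> complex_Lfun 1 W ->
  cexpectation P (fun w => Z w + W w) = cexpectation P Z + cexpectation P W.
Proof.
move=> [Zr Zi] [Wr Wi]; apply/eqP; rewrite eq_complex /=; apply/andP; split.
- have /eqP := fine_expectation_linear 1 1 _ _ Zr Wr; rewrite !mul1r.
  congr (fine (expectation _ _) == _).
  by apply/funext => w; rewrite !mul1r raddfD.
- have /eqP := fine_expectation_linear 1 1 _ _ Zi Wi; rewrite !mul1r.
  congr (fine (expectation _ _) == _).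
  by apply/funext => w; rewrite !mul1r raddfD.
Qed.

Lemma cexpectationZ (c : R[i]) (Z : T -> R[i]) : complex_Lfun 1 Z ->
  cexpectation P (fun w => c * Z w) = c * cexpectation P Z.
Proof.
move=> [Zr Zi]; apply/eqP; case: c => a b.
rewrite eq_complex /=; apply/andP; split.
- have /eqP := fine_expectation_linear a (- b) _ _ Zr Zi; rewrite mulNr.
  congr (fine (expectation _ _) == _).
  by apply/funext => w; case: (Z w) => x y /=; rewrite mulNr.
- have /eqP := fine_expectation_linear a b _ _ Zi Zr.
  congr (fine (expectation _ _) == _).
  by apply/funext => w; case: (Z w) => x y.
Qed.

Lemma cexpectation0 : cexpectation P (fun=> 0) = 0.
Proof.
by rewrite /cexpectation /= (expectation_cst P 0).
Qed.

Lemma cexpectation_sum (I : Type) (s : seq I) (Z : I -> T -> R[i]) :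
  (forall i, complex_Lfun 1 (Z i)) ->
  cexpectation P (fun w => \sum_(i <- s) Z i w) =
  \sum_(i <- s) cexpectation P (Z i).
Proof.
move=> LZ; elim: s => [|i s IHs].
  rewrite big_nil -[RHS]cexpectation0; congr cexpectation.
  by apply/funext => w; rewrite big_nil.
rewrite big_cons -IHs -cexpectationD//; last exact: complex_Lfun_sum.
by congr cexpectation; apply/funext => w; rewrite big_cons.
Qed.

Lemma cexpectation_conj (Z : T -> R[i]) : complex_Lfun 1 Z ->
  cexpectation P (fun w => Num.conj (Z w)) = Num.conj (cexpectation P Z).
Proof.
move=> [Zr Zi]; apply/eqP; rewrite eq_complex /=; apply/andP; split.
- by apply/eqP; congr (fine (expectation _ _)); apply/funext => w; case: (Z w).
(* The sign change is the linear identity with coefficients -1 and 0; the second function is a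
   dummy. *)
- have /eqP := fine_expectation_linear (- 1) 0 _ _ Zi Zi.
  rewrite mul0r addr0 mulN1r.
  congr (fine (expectation _ _) == _).
  by apply/funext => w; case: (Z w) => x y /=; rewrite mul0r addr0 mulN1r.
Qed.

(** In the order of [R[i]], [0 <= z] means that [z] has zero imaginary part and nonnegative real
    part; [fine] maps nonnegative extended reals to nonnegative reals, [+oo] going to 0. *)
Lemma cexpectation_ge0 (Z : T -> R[i]) :
  (forall w, 0 <= Z w) -> 0 <= cexpectation P Z.
Proof.
move=> Z0; rewrite lecE /=; apply/andP; split.
  rewrite (_ : (fun w => complex.Im (Z w)) = cst 0) ?expectation_cst//.
  by apply/funext => w; rewrite ger0_Im.
apply: fine_ge0; apply: expectation_ge0 => w.
by have := Z0 w; rewrite lecE => /andP[].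
Qed.

(** * Correlation matrix of a square-integrable random vector *)

Section correlation.
Context (n : nat) (g : T -> 'cV[R[i]]_n).
Hypothesis g2 : forall i, complex_Lfun 2%:E (fun w => g w i 0).

Let outerE w i j :
  (g w *m map_mx Num.conj (g w)^T) i j = g w i 0 * Num.conj (g w j 0).
Proof. by rewrite mxE big_ord1 !mxE. Qed.

Let correlation_mxE i j : correlation_mx P g i j =
  cexpectation P (fun w => g w i 0 * Num.conj (g w j 0)).
Proof.
by rewrite mxE; congr cexpectation; apply/funext => w; rewrite outerE.
Qed.

(** Conjugating [g_i * conj g_j] exchanges the two indices, and conjugation passes through the
    expectation. *)
Lemma correlation_mx_herm :
  correlation_mx P g = map_mx Num.conj (correlation_mx P g)^T.
Proof.
apply/matrixP => i j; rewrite [RHS]mxE [X in Num.conj X]mxE !correlation_mxE.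
rewrite -cexpectation_conj; last exact: complex_Lfun2_mul_conj.
by congr cexpectation; apply/funext => w; rewrite rmorphM/= conjCK mulrC.
Qed.

Lemma correlation_mx_psd (u : 'rV[R[i]]_n) :
  0 <= (u *m correlation_mx P g *m map_mx Num.conj u^T) 0 0.
Proof.
pose h w := \sum_i u 0 i * g w i 0.
suff -> : (u *m correlation_mx P g *m map_mx Num.conj u^T) 0 0 =
    cexpectation P (fun w => h w * Num.conj (h w)).
  by apply: cexpectation_ge0 => w; exact: mul_conjC_ge0.
have LG i j := complex_Lfun2_mul_conj _ _ (g2 i) (g2 j).
(* The outer sum runs over [j], the index of the conjugated factor, because the matrix product
   [(u *m C) *m u^H] unfolds in that order; the two double sums can then be compared term by
   term. *)
have -> : (fun w => h w * Num.conj (h w)) =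
    (fun w => \sum_j \sum_i
      u 0 i * Num.conj (u 0 j) * (g w i 0 * Num.conj (g w j 0))).
  apply/funext => w; rewrite /h rmorph_sum mulr_sumr; apply: eq_bigr => j _.
  by rewrite mulr_suml; apply: eq_bigr => i _; rewrite rmorphM/=; ring.
have L1 i j := complex_LfunZ 1 (u 0 i * Num.conj (u 0 j)) _ (lexx _) (LG i j).
rewrite cexpectation_sum; last by move=> j; exact: complex_Lfun_sum.
rewrite mxE; apply: eq_bigr => j _; rewrite cexpectation_sum//.
rewrite !mxE mulr_suml; apply: eq_bigr => i _.
by rewrite cexpectationZ// correlation_mxE mulrAC.
Qed.

End correlation.

(** Taking the whole line for one of the two sets in the joint law leaves the marginal law of the
    other part, which is a centered normal law. *)
Lemma circular_normal_Lfun2 (Z : T -> R[i]) (v : R) :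
  circular_normal P Z v -> complex_Lfun 2%:E Z.
Proof.
move=> [mr mi PZ].
have total (s : R) : centered_normal s setT = 1%E.
  rewrite /centered_normal; case: ifP => _; first by rewrite diracT.
  exact: probability_setT.
split; apply: (centered_normal_Lfun2 _ _ _ _ _ (Num.sqrt (v / 2))) => // A mA.
- have := PZ _ _ mA measurableT; rewrite total mule1 => <-.
  by congr (P _); apply/seteqP; split => w //= [].
- have := PZ _ _ measurableT mA; rewrite total mul1e => <-.
  by congr (P _); apply/seteqP; split => w //= [].
Qed.

End complex_expectation.

(** * High-SNR slopes of the two sensing rates *)

Lemma scaled_log2det_slope (R : realType) (n : nat) (C : 'M[R[i]]_n)
    (c k : R) (rate : R -> R) : 0 < k ->
  C = map_mx Num.conj C^T ->
  (forall u : 'rV[R[i]]_n, 0 <= (u *m C *m map_mx Num.conj u^T) 0 0) ->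
  (forall p, rate p = c * log2det (k * p) C) ->
  high_snr_slope rate (c * (\rank C)%:R).
Proof.
move=> k0 Ch Cp rateE; rewrite /high_snr_slope.
have -> : (fun p => rate p / log2 p) =
    (fun p => c * (log2det (k * p) C / log2 p)).
  by apply/funext => p; rewrite rateE mulrA.
by apply: cvgMr; exact: log2det_slope.
Qed.

Lemma sensing_rate_isac_slope (R : realType) (n L : nat) (sigmas : R)
    (C : 'M[R[i]]_n) : (0 < L)%N -> 0 < sigmas ->
  C = map_mx Num.conj C^T ->
  (forall u : 'rV[R[i]]_n, 0 <= (u *m C *m map_mx Num.conj u^T) 0 0) ->
  high_snr_slope (sensing_rate_isac L sigmas C) ((\rank C)%:R / L%:R).
Proof.
move=> L0 s0 Ch Cp; rewrite mulrC.
have k0 : 0 < L%:R / sigmas ^+ 2 by rewrite divr_gt0 ?ltr0n ?exprn_gt0.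
apply: (scaled_log2det_slope _ _ _ _ _ _ k0 Ch Cp).
move=> p; rewrite /sensing_rate_isac.
by have -> : p * L%:R / sigmas ^+ 2 = L%:R / sigmas ^+ 2 * p by ring.
Qed.

(** For [kappa < 1] the condition [mu < 1] makes the gain in front of [p] positive; with [mu = 1] no
    power would be left for sensing and the rate would vanish whatever the rank. For [kappa = 1] the
    rate and the claimed slope are both 0. *)
Lemma sensing_rate_fdsac_slope (R : realType) (n L : nat) (sigmas kappa mu : R)
    (C : 'M[R[i]]_n) : (0 < L)%N -> 0 < sigmas -> kappa <= 1 ->
  (kappa < 1 -> mu < 1) -> C = map_mx Num.conj C^T ->
  (forall u : 'rV[R[i]]_n, 0 <= (u *m C *m map_mx Num.conj u^T) 0 0) ->
  high_snr_slope (sensing_rate_fdsac L sigmas kappa mu C)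
    ((1 - kappa) * (\rank C)%:R / L%:R).
Proof.
move=> L0 s0; rewrite le_eqVlt => /predU1P[-> _ _ _|k1 /(_ k1) m1 Ch Cp].
  rewrite subrr !mul0r /high_snr_slope.
  rewrite (_ : (fun p => _) = cst 0); first exact: cvg_cst.
  by apply/funext => p; rewrite /sensing_rate_fdsac subrr !mul0r.
rewrite mulrAC.
have k0 : 0 < (1 - mu) * L%:R / ((1 - kappa) * sigmas ^+ 2).
  by rewrite divr_gt0 // mulr_gt0 ?exprn_gt0 // ?subr_gt0 // ltr0n.
apply: (scaled_log2det_slope _ _ _ _ _ _ k0 Ch Cp).
move=> p; rewrite /sensing_rate_fdsac.
by rewrite [(1 - mu) * p * _]mulrAC [_ * p / _]mulrAC.
Qed.

Theorem mainTheorem7 (R : realType) (d : measure_display)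
    (T : measurableType d) (P : probability T R)
    (M L K : nat) (hM : (0 < M)%N) (hL : (0 < L)%N)
    (a : R -> 'cV[R[i]]_M) (theta : 'I_K -> R)
    (beta : 'I_K -> T -> R[i]) (sigma : 'I_K -> R)
    (hbeta : forall k : 'I_K, circular_normal P (beta k) (sigma k ^+ 2))
    (sigmas : R) (hsigmas : 0 < sigmas)
    (kappa mu : R) (hkappa : 0 <= kappa <= 1) (hmu : 0 <= mu <= 1)
    (hsensing : kappa < 1 -> mu < 1) :
  let C := correlation_mx P (target_response a theta beta) in
  high_snr_slope (sensing_rate_isac L sigmas C)
    ((\rank C)%:R / L%:R)
  /\ high_snr_slope (sensing_rate_fdsac L sigmas kappa mu C)
    ((1 - kappa) * (\rank C)%:R / L%:R).
Proof.
move=> C.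
(* Each entry of the target response is a combination of the amplitudes with deterministic
   coefficients, so it inherits their square integrability. *)
have g2 i : complex_Lfun _ _ _ P 2%:E
    (fun w => target_response a theta beta w i 0).
  have -> : (fun w => target_response a theta beta w i 0) =
      (fun w => \sum_(k < K) a (theta k) i 0 * beta k w).
    apply/funext => w; rewrite /target_response summxE.
    by apply: eq_bigr => k _; rewrite mxE mulrC.
  apply: complex_Lfun_sum => [|k]; first by rewrite lee1n.
  apply: complex_LfunZ; first by rewrite lee1n.
  exact: circular_normal_Lfun2 (hbeta k).
have Ch := correlation_mx_herm _ _ _ _ _ _ g2.
have Cp := correlation_mx_psd _ _ _ _ _ _ g2.
split; first exact: sensing_rate_isac_slope.
by apply: sensing_rate_fdsac_slope => //; case/andP: hkappa.
Qed.
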